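(* For $n\ge 0$ let $C_{2n}(132)$ be the set of centrosymmetric permutations of $[2n]=\{1,\dots,2n\}$ avoiding the pattern $132$, let $q_{n,k}$ be the number of elements of $C_{2n}(132)$ with exactly $k$ descents, and let $$Q(x,y)=\sum_{n\ge 0}\sum_{\sigma\in C_{2n}(132)}x^n y^{\mathrm{des}(\sigma)}=\sum_{n,k\ge0}q_{n,k}x^ny^k .$$ Then $$Q(x,y)=1+\frac{x(1+y)}{1-x(1+y^2)}.$$ Hence, for every $n\ge 1$ and $k\ge 0$, $q_{n,k}=\binom{n-1}{\lfloor k/2\rfloor}$.
   Context: A permutation $\sigma$ of $[m]$ is centrosymmetric if $\sigma(i)+\sigma(m+1-i)=m+1$ for all $i$. A permutation $\sigma$ of $[m]$ avoids the pattern $132$ if there are no indices $i<j<k$ with $\sigma(i)<\sigma(k)<\sigma(j)$. A descent of $\sigma$ is an index $i$ with $\sigma(i)>\sigma(i+1)$, and $\mathrm{des}(\sigma)$ is the number of descents. $C_0(132)$ consists of the empty permutation, with $0$ descents. *)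

(* Defs.v *)
From HB Require Import structures.
From mathcomp Require Import all_boot all_order all_algebra all_fingroup.
From mathcomp Require Import boolp.

Set Implicit Arguments.
Unset Strict Implicit.
Unset Printing Implicit Defensive.

Import GRing.Theory.
Local Open Scope ring_scope.

(** * Formal power series in one variable: [Fps a] is the sum of the [a n] X^n.
    Series in two variables x, y are obtained by iteration: R[[x,y]] = R[[y]][[x]]
    is [fps (fps R)]. *)

Record fps (R : Type) := Fps { fpscoef : nat -> R }.

Section EqChoice.
Variable R : Type.

Lemma fpsP (f g : fps R) : (forall n, fpscoef f n = fpscoef g n) <-> f = g.
Proof.
split=> [|-> //]; case: f => a; case: g => b /= ab.
by congr Fps; apply/funext.
Qed.

HB.instance Definition _ := gen_eqMixin (fps R).
HB.instance Definition _ := gen_choiceMixin (fps R).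
End EqChoice.

Section Ring.
Variable R : comNzRingType.
Implicit Types f g h : fps R.

Definition fps_zero : fps R := Fps (fun _ => 0).
Definition fps_opp f : fps R := Fps (fun n => - fpscoef f n).
Definition fps_add f g : fps R := Fps (fun n => fpscoef f n + fpscoef g n).
Definition fps_one : fps R := Fps (fun n => (n == 0%N)%:R).
Definition fps_mul f g : fps R :=
  Fps (fun n => \sum_(i < n.+1) fpscoef f i * fpscoef g (n - i)).

Lemma fps_addA : associative fps_add.
Proof. by move=> f g h; apply/fpsP => n /=; rewrite addrA. Qed.
Lemma fps_addC : commutative fps_add.
Proof. by move=> f g; apply/fpsP => n /=; rewrite addrC. Qed.
Lemma fps_add0 : left_id fps_zero fps_add.
Proof. by move=> f; apply/fpsP => n /=; rewrite add0r. Qed.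
Lemma fps_addN : left_inverse fps_zero fps_opp fps_add.
Proof. by move=> f; apply/fpsP => n /=; rewrite addNr. Qed.

HB.instance Definition _ :=
  GRing.isZmodule.Build (fps R) fps_addA fps_addC fps_add0 fps_addN.

Definition fps_trunc N f : {poly R} := \poly_(i < N.+1) fpscoef f i.

Lemma coef_fps_trunc N f n : (n <= N)%N -> (fps_trunc N f)`_n = fpscoef f n.
Proof. by move=> nN; rewrite coef_poly ltnS nN. Qed.

Lemma fps_mul_trunc N f g n : (n <= N)%N ->
  fpscoef (fps_mul f g) n = (fps_trunc N f * fps_trunc N g)`_n.
Proof.
move=> nN; rewrite coefM /=; apply: eq_bigr => i _.
by rewrite !coef_fps_trunc // (leq_trans _ nN) ?leq_subr // -ltnS.
Qed.

Lemma fps_mulC : commutative fps_mul.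
Proof.
by move=> f g; apply/fpsP => n; rewrite !(@fps_mul_trunc n) // mulrC.
Qed.

Lemma fps_mulA : associative fps_mul.
Proof.
move=> f g h; apply/fpsP => n.
transitivity ((fps_trunc n f * fps_trunc n g * fps_trunc n h)`_n).
  rewrite -mulrA coefM; apply: eq_bigr => i _.
  by rewrite (@fps_mul_trunc n) ?leq_subr // coef_fps_trunc // -ltnS.
rewrite coefM; apply: eq_bigr => i _.
by rewrite (@fps_mul_trunc n) ?coef_fps_trunc ?leq_subr // -ltnS.
Qed.

Lemma fps_mul1 : left_id fps_one fps_mul.
Proof.
move=> f; apply/fpsP => n /=.
rewrite big_ord_recl subn0 mul1r big1 ?addr0 // => i _.
by rewrite mul0r.
Qed.

Lemma fps_mulD : left_distributive fps_mul fps_add.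
Proof.
move=> f g h; apply/fpsP => n /=; rewrite -big_split.
by apply: eq_bigr => i _; rewrite mulrDl.
Qed.

Lemma fps_one_neq0 : fps_one != 0.
Proof.
apply/eqP => /fpsP /(_ 0%N) /= /eqP.
by rewrite oner_eq0.
Qed.

HB.instance Definition _ := GRing.Zmodule_isComNzRing.Build (fps R)
  fps_mulA fps_mulC fps_mul1 fps_mulD fps_one_neq0.

Definition fpsC (c : R) : fps R := Fps (fun n => if n == 0%N then c else 0).
Definition fpsX : fps R := Fps (fun n => (n == 1%N)%:R).

Lemma coef_fps0 n : fpscoef (0 : fps R) n = 0. Proof. by []. Qed.
Lemma coef_fps1 n : fpscoef (1 : fps R) n = (n == 0%N)%:R. Proof. by []. Qed.
Lemma coef_fpsD f g n : fpscoef (f + g) n = fpscoef f n + fpscoef g n.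
Proof. by []. Qed.
Lemma coef_fpsN f n : fpscoef (- f) n = - fpscoef f n. Proof. by []. Qed.
Lemma coef_fpsM f g n :
  fpscoef (f * g) n = \sum_(i < n.+1) fpscoef f i * fpscoef g (n - i).
Proof. by []. Qed.
Lemma coef0_fpsM f g : fpscoef (f * g) 0 = fpscoef f 0 * fpscoef g 0.
Proof. by rewrite coef_fpsM big_ord1. Qed.

Lemma coef_fpsXM f n :
  fpscoef (fpsX * f) n = if n is m.+1 then fpscoef f m else 0.
Proof.
case: n => [|n]; first by rewrite coef0_fpsM mul0r.
rewrite coef_fpsM big_ord_recl mul0r add0r big_ord_recl mul1r subSS subn0.
by rewrite big1 ?addr0 // => i _; rewrite mul0r.
Qed.

Lemma coef_fpsXn m n : fpscoef (fpsX ^+ m) n = (n == m)%:R.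
Proof.
elim: m n => [|m IH] n; first by rewrite expr0 coef_fps1.
by rewrite exprS coef_fpsXM; case: n => // n; rewrite IH eqSS.
Qed.

End Ring.

Section UnitRing.
Variable R : comUnitRingType.
Implicit Types f g : fps R.

Definition fps_unit : pred (fps R) := fun f => fpscoef f 0 \is a GRing.unit.

(* The list of the first n + 1 coefficients of 1 / f, in order. *)
Fixpoint fps_inv_seq f n : seq R :=
  if n is m.+1 then
    let s := fps_inv_seq f m in
    rcons s (- (fpscoef f 0)^-1 * \sum_(i < m.+1) s`_i * fpscoef f (m.+1 - i))
  else [:: (fpscoef f 0)^-1].

Definition fps_inv f : fps R :=
  if fps_unit f then Fps (fun n => (fps_inv_seq f n)`_n) else f.

Lemma size_fps_inv_seq f n : size (fps_inv_seq f n) = n.+1.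
Proof. by elim: n => //= n IH; rewrite size_rcons IH. Qed.

Lemma nth_fps_inv_seq f n i : (i <= n)%N ->
  (fps_inv_seq f n)`_i = (fps_inv_seq f i)`_i.
Proof.
elim: n => [|n IH]; first by rewrite leqn0 => /eqP ->.
rewrite leq_eqVlt => /predU1P[-> //|i_n].
by rewrite [LHS]/= nth_rcons size_fps_inv_seq i_n IH.
Qed.

Lemma fps_mulV : {in fps_unit, left_inverse 1 fps_inv *%R}.
Proof.
move=> f uf; have u0 : fpscoef f 0 \is a GRing.unit by exact: uf.
rewrite /fps_inv (uf : fps_unit f); apply/fpsP => n; rewrite coef_fpsM coef_fps1.
case: n => [|n]; first by rewrite big_ord1 /= mulVr.
rewrite big_ord_recr /= subnn nth_rcons size_fps_inv_seq ltnn eqxx.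
rewrite mulrAC mulNr mulVr // mulN1r; apply/eqP; rewrite subr_eq0.
apply/eqP/eq_bigr => i _.
by rewrite (@nth_fps_inv_seq _ n) // -ltnS.
Qed.

Lemma fps_unitP f g : g * f = 1 -> fps_unit f.
Proof.
move=> /(congr1 (fun h => fpscoef h 0)); rewrite coef0_fpsM /= => gf.
by apply/unitrPr; exists (fpscoef g 0); rewrite mulrC.
Qed.

Lemma fps_inv_out : {in [predC fps_unit], fps_inv =1 id}.
Proof. by move=> f /negbTE uf; rewrite /fps_inv (uf : fps_unit f = false). Qed.

HB.instance Definition _ := GRing.ComNzRing_hasMulInverse.Build (fps R)
  fps_mulV fps_unitP fps_inv_out.

Lemma fps_unitE f : (f \is a GRing.unit) = (fpscoef f 0 \is a GRing.unit).
Proof. by []. Qed.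

End UnitRing.

(** * Permutations of [m] are modelled by ['S_m], acting on 0, ..., m - 1. *)

Section Permutations.
Variable m : nat.
Implicit Type s : 'S_m.

(* With 1-based indices, [rev_ord i] is m + 1 - i, and the successors turn the
   0-based values into 1-based ones. *)
Definition centrosymmetric s : bool :=
  [forall i : 'I_m, (s i).+1 + (s (rev_ord i)).+1 == m.+1]%N.

Definition avoids132 s : bool :=
  [forall i : 'I_m, forall j : 'I_m, forall k : 'I_m,
    (i < j < k)%N ==> ~~ (s i < s k < s j)%N].

Definition des s : nat :=
  #|[set i : 'I_m | [exists j : 'I_m, (j == i.+1 :> nat) && (s j < s i)%N]]|.

End Permutations.

Definition C132 (m : nat) : {set 'S_m} := [set s | centrosymmetric s && avoids132 s].

Definition q (n k : nat) : nat := #|[set s in C132 (2 * n) | des s == k]|.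

(** * The ring Z[[x,y]] *)

Definition series2 := fps (fps int).

Definition x : series2 := fpsX (fps int).
Definition y : series2 := fpsC (fpsX int).

(* The coefficient of x^n is the series in y given by the inner sum. *)
Definition Q : series2 :=
  Fps (fun n => \sum_(s in C132 (2 * n)) fpsX int ^+ des s).

(* Division in a [unitRingType] is the true one only for unit denominators. *)
Lemma denominator_unit : 1 - x * (1 + y ^+ 2) \is a GRing.unit.
Proof.
by rewrite fps_unitE coef_fpsD coef_fpsN coef_fpsXM subr0 unitr1.
Qed.

(* Main.v *)
Require Import Defs.
From HB Require Import structures.
From mathcomp Require Import all_boot all_order all_algebra all_fingroup.
From mathcomp Require Import zify.
Import GRing.Theory.

Set Implicit Arguments.
Unset Strict Implicit.
Unset Printing Implicit Defensive.

Local Open Scope ring_scope.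

(** Reverse-complement fixes a centrosymmetric permutation and exchanges the
    patterns 132 and 213, so the elements of C_m(132) avoid both.  Such a
    permutation is a skew sum of increasing runs, hence is determined by its
    descent set: for i < j one has s i < s j exactly when there is no descent
    between i and j.  Conversely every subset of the m - 1 adjacent positions
    that is symmetric under reflection is the descent set of an element of
    C_m(132).  For m = 2(n+1), a symmetric set with k elements amounts to k./2
    elements among the first n positions, the middle position being included
    exactly when k is odd. *)

(* The values are extended by m outside [0, m), so that no position i with
   i.+1 >= m is a descent. *)
Definition perm_val (m : nat) (s : 'S_m) (i : nat) : nat :=
  oapp (fun j : 'I_m => nat_of_ord (s j)) m (insub i).

Definition descent (m : nat) (s : 'S_m) (i : nat) : bool :=
  (perm_val s i.+1 < perm_val s i)%N.

(** * Values, descents and the relative order of a permutation *)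

Section PermutationValues.
Local Open Scope nat_scope.
Variable m : nat.
Implicit Types s t : 'S_m.

Lemma perm_val_ord s (i : 'I_m) : perm_val s i = s i.
Proof. by rewrite /perm_val valK. Qed.

Lemma perm_val_out s i : m <= i -> perm_val s i = m.
Proof. by move=> mi; rewrite /perm_val insubF // ltnNge mi. Qed.

Lemma perm_val_inj s i j : i < m -> j < m -> perm_val s i = perm_val s j -> i = j.
Proof.
move=> im jm.
rewrite (perm_val_ord s (Ordinal im)) (perm_val_ord s (Ordinal jm)).
by move=> /val_inj /perm_inj [].
Qed.

Lemma perm_val_lt s i : i < m -> perm_val s i < m.
Proof. by move=> im; rewrite (perm_val_ord s (Ordinal im)). Qed.

Lemma descent_out s i : m <= i.+1 -> descent s i = false.
Proof.
move=> mi; rewrite /descent (perm_val_out s mi) ltnNge.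
case: (leqP m i) => im; first by rewrite perm_val_out ?leqnn.
by rewrite ltnW ?perm_val_lt.
Qed.

Lemma des_sum s : des s = \sum_(i < m) descent s i.
Proof.
rewrite /des -sum1_card big_mkcond /=; apply: eq_bigr => i _.
rewrite inE; suff -> : [exists j : 'I_m, (j == i.+1 :> nat) && (s j < s i)] =
  descent s i by case: (descent s i).
apply/existsP/idP => [[j /andP[/eqP ji sji]]|].
  by rewrite /descent -ji !perm_val_ord.
case: (ltnP i.+1 m) => im; last by rewrite descent_out.
rewrite /descent (perm_val_ord s (Ordinal im)) perm_val_ord => d.
by exists (Ordinal im); rewrite eqxx.
Qed.

(** The value at i is the number of positions with smaller values, so relative order fixes a
    permutation. Pairs with i > j follow from those with i < j, since values at distinct positions
    differ. *)
Lemma perm_ltn_inj s t :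
  (forall i j : 'I_m, i < j -> (s i < s j) = (t i < t j)) -> s = t.
Proof.
move=> st.
have st' (i j : 'I_m) : (s i < s j) = (t i < t j).
  case: (ltngtP i j) => [/st //|ji|/val_inj ->]; last by rewrite !ltnn.
  have := st _ _ ji.
  have : s i != s j :> nat.
    by apply/eqP => /val_inj /perm_inj E; rewrite E ltnn in ji.
  have : t i != t j :> nat.
    by apply/eqP => /val_inj /perm_inj E; rewrite E ltnn in ji.
  by lia.
have rank (u : 'S_m) i : u i = #|[set j | u j < u i]| :> nat.
  have -> : [set j | u j < u i] = u @^-1: [set k : 'I_m | k < u i].
    by apply/setP => j; rewrite !inE.
  rewrite card_preimset; last exact: perm_inj.
  rewrite -sum1dep_card (big_ord_narrow (ltnW (ltn_ord (u i)))) /=.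
  by rewrite sum_nat_const card_ord muln1.
apply/permP => i; apply/val_inj; rewrite [LHS]rank [RHS]rank.
by apply: eq_card => j; rewrite !inE st'.
Qed.

(** * Structure of the elements of C_m(132) *)

Section C132.
Variable s : 'S_m.
Hypothesis sC : s \in C132 m.

Lemma C132_centro i : i < m -> (perm_val s i + perm_val s (m.-1 - i)).+1 = m.
Proof.
move=> im; move: sC; rewrite inE => /andP[/forallP /(_ (Ordinal im)) /eqP + _].
rewrite -!perm_val_ord /=.
have -> : m - i.+1 = m.-1 - i by lia.
by lia.
Qed.

Lemma C132_avoids132 i j k : i < j -> j < k -> k < m ->
  ~ (perm_val s i < perm_val s k < perm_val s j).
Proof.
move=> ij jk km; have jm := ltn_trans jk km; have im := ltn_trans ij jm.
move: sC; rewrite inE => /andP[_ /forallP/(_ (Ordinal im))].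
move=> /forallP/(_ (Ordinal jm)) /forallP/(_ (Ordinal km)).
by rewrite /= ij jk /= -!perm_val_ord => /negP.
Qed.

Lemma C132_avoids213 i j k : i < j -> j < k -> k < m ->
  ~ (perm_val s j < perm_val s i < perm_val s k).
Proof.
move=> ij jk km H.
have jm := ltn_trans jk km; have im := ltn_trans ij jm.
have := C132_centro im; have := C132_centro jm; have := C132_centro km.
have := @C132_avoids132 (m.-1 - k) (m.-1 - j) (m.-1 - i).
by lia.
Qed.

(** Reversing positions and complementing values each flip the comparison of neighbours, and the two
    flips cancel. *)
Lemma C132_descent_mirror i : i.+1 < m -> descent s (m - i.+2) = descent s i.
Proof.
move=> im; rewrite /descent.
have := C132_centro im; have := C132_centro (ltnW im).
have -> : (m - i.+2).+1 = m.-1 - i by lia.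
have -> : m - i.+2 = m.-1 - i.+1 by lia.
by lia.
Qed.

(** Avoiding 213 at l, l+1, j puts s j below s l; avoiding 132 at i, l, j then puts it below s i. *)
Lemma C132_descent_gt i l j : i <= l -> l < j -> j < m -> descent s l ->
  perm_val s j < perm_val s i.
Proof.
move=> il lj jm d; rewrite /descent in d.
have ne a b : a < m -> b < m -> a <> b -> perm_val s a <> perm_val s b.
  by move=> am bm ab /(perm_val_inj am bm).
have jl : perm_val s j < perm_val s l.
  have := @C132_avoids213 l l.+1 j (leqnn _).
  have := ne j l.
  case: (ltngtP l.+1 j) lj d => // [|<-]; by lia.
case: (ltngtP i l) il => // [il _|-> _ //].
have := @C132_avoids132 i l j il lj jm.
have := ne i j.
by lia.
Qed.

Lemma C132_ltn i j : i < j -> j < m ->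
  (perm_val s i < perm_val s j) = ~~ has (descent s) (iota i (j - i)).
Proof.
move=> ij jm; case: hasP => [[l]|nd] /=.
  rewrite mem_iota subnKC ?(ltnW ij) // => /andP[il lj] d.
  by have := C132_descent_gt il lj jm d; lia.
have {}nd l : i <= l < j -> ~~ descent s l.
  move=> ilj; apply/negP => d; apply: nd; exists l => //.
  by rewrite mem_iota subnKC ?(ltnW ij).
elim: j ij jm nd => // j IH; rewrite ltnS leq_eqVlt => ij jm nd.
have step : perm_val s j < perm_val s j.+1.
  have := nd j; rewrite /descent.
  have : perm_val s j <> perm_val s j.+1 by move/perm_val_inj; lia.
  by lia.
case/predU1P: ij => [-> //|ij].
apply: ltn_trans step; apply: IH => // [|l li]; first by lia.
by apply: nd; lia.
Qed.

End C132.

Lemma C132_descent_inj s t : s \in C132 m -> t \in C132 m ->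
  (forall i, i.+1 < m -> descent s i = descent t i) -> s = t.
Proof.
move=> sC tC st; apply: perm_ltn_inj => i j ij.
rewrite -!perm_val_ord !C132_ltn //; congr (~~ _).
apply: eq_in_has => l; rewrite mem_iota => lij; apply: st.
by have := ltn_ord j; lia.
Qed.

(** * Permutations with a prescribed symmetric descent set *)

(** In a strict total order the number of predecessors is strictly monotone, hence injective, and it
    is below m because no element precedes itself. *)
Lemma rank_perm (r : rel 'I_m) : irreflexive r -> transitive r ->
  (forall i j, i != j -> r i j || r j i) ->
  exists s : 'S_m, (forall i, s i = #|[set j | r j i]| :> nat) /\
    (forall i j, (s i < s j) = r i j).
Proof.
move=> rI rT rt.
have rk_mono i j : r i j -> #|[set k | r k i]| < #|[set k | r k j]|.
  move=> rij; apply: proper_card; apply/properP; split.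
    by apply/subsetP => k; rewrite !inE => /rT; apply.
  by exists i; rewrite !inE ?rI.
have rk_lt i : #|[set j | r j i]| < m.
  rewrite -[ltnRHS]card_ord -cardsT; apply: proper_card; apply/properP.
  by split; [exact: subsetT|exists i; rewrite !inE ?rI].
have rk_inj : injective (fun i => Ordinal (rk_lt i)).
  move=> i j [E]; apply/eqP/negPn/negP => /rt.
  by case/orP => /rk_mono; rewrite E ltnn.
exists (perm rk_inj); split=> [i|i j]; rewrite !permE //=.
apply/idP/idP => [lt|/rk_mono //].
have /rt/orP[//|/rk_mono] : i != j by apply: contraTneq lt => ->; rewrite ltnn.
by move=> /(ltn_trans lt); rewrite ltnn.
Qed.

(* [b i] numbers the increasing run containing position i, and the runs are
   arranged in decreasing order. *)
Lemma C132_descent_exists (d : nat -> bool) :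
  (forall i, i.+1 < m -> d (m - i.+2) = d i) ->
  exists2 s, s \in C132 m & forall i, i.+1 < m -> descent s i = d i.
Proof.
move=> dsym; pose b i := \sum_(0 <= l < i) d l.
have bS i : b i.+1 = b i + d i by rewrite /b big_nat_recr.
have bmono i j : i <= j -> b i <= b j.
  by move=> ij; rewrite [b j](@big_cat_nat _ _ _ i) //= leq_addr.
(* By symmetry of [d], the last i of the m - 1 adjacent positions contribute as much as the first
   i. *)
have brev i : i < m -> b (m.-1 - i) + b i = b m.-1.
  move=> im; rewrite [RHS](@big_cat_nat _ _ _ (m.-1 - i)) ?leq_subr //=.
  congr (_ + _); rewrite -[m.-1 - i]add0n big_addn.
  have -> : m.-1 - (m.-1 - i) = i by lia.
  rewrite big_nat_rev; apply: eq_big_nat => l /andP[_ li].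
  rewrite -dsym; last by lia.
  by congr (nat_of_bool (d _)); lia.
(* The intended meaning of [r i j] is s i < s j: i lies in a later run, or earlier in the same
   run. *)
pose r := [rel i j : 'I_m | (b j < b i) || (b i == b j) && (i < j)].
have rI : irreflexive r by move=> i; rewrite /= !ltnn andbF.
have rT : transitive r by move=> j i k /=; lia.
have rt i j : i != j -> r i j || r j i.
  by move=> ij; have : i != j :> nat by []; rewrite /=; lia.
have [s [sE slt]] := rank_perm rI rT rt.
have rrev i j : r (rev_ord i) (rev_ord j) = r j i.
  rewrite /=; have := brev i (ltn_ord i); have := brev j (ltn_ord j).
  have -> : m - i.+1 = m.-1 - i by lia.
  have -> : m - j.+1 = m.-1 - j by lia.
  by have := ltn_ord i; have := ltn_ord j; lia.
exists s => [|i im].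
  rewrite inE; apply/andP; split; apply/forallP => i.
    (* Reflection reverses [r], so the value at the mirror of i counts the elements above i. With
       those below i they make up all m - 1 others. *)
    have -> : s (rev_ord i) = #|[set j | r i j]| :> nat.
      rewrite sE -(card_preimset _ (@rev_ord_inj m)).
      by apply: eq_card => j; rewrite !inE; exact: rrev.
    have : #|[set j | r j i]| + #|[set j | r i j]| = #|[set~ i]|.
      rewrite -cardsUI [X in _ + #|pred_of_set X|](_ : _ = set0) ?cards0 ?addn0.
        apply: eq_card => j; rewrite !inE; apply/idP/idP; last exact: rt.
        by apply: contraTneq => ->; lia.
      by apply/setP => j; rewrite !inE; lia.
    by rewrite cardsC1 card_ord -sE; have := ltn_ord i; lia.
  apply/forallP => j; apply/forallP => k; apply/implyP => /andP[ij jk].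
  (* As [b] is monotone, s i < s k forces i, j, k into one run, where s j < s k. *)
  rewrite !slt /=.
  by have := bmono _ _ (ltnW ij); have := bmono _ _ (ltnW jk); lia.
rewrite /descent (perm_val_ord s (Ordinal im)).
rewrite (perm_val_ord s (Ordinal (ltnW im))).
by rewrite slt /= bS; case: (d i); lia.
Qed.

End PermutationValues.

(** * Counting by the left half of the descent set *)

Section Counting.
Local Open Scope nat_scope.

Lemma sum_palindrome n (d : nat -> nat) :
  (forall i, i < n -> d (n.*2 - i) = d i) ->
  \sum_(i < n.*2.+1) d i = (\sum_(i < n) d i).*2 + d n.
Proof.
move=> dsym; rewrite -!(big_mkord predT) (@big_cat_nat _ _ _ n) //=; last by lia.
rewrite (@big_ltn _ _ _ n); last by lia.
rewrite -[in \sum_(n.+1 <= i < _) _](add0n n.+1) big_addn.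
have -> : n.*2.+1 - n.+1 = n by lia.
rewrite [X in _ + (_ + X)](_ : _ = \sum_(0 <= i < n) d i); first by lia.
rewrite big_nat_rev; apply: eq_big_nat => i /andP[_ i_n].
by rewrite -[RHS]dsym //; congr d; lia.
Qed.

(** There are 2n + 1 adjacent positions, with n in the middle; only those strictly left of it are
    kept. *)
Definition half_descents n (s : 'S_(2 * n.+1)) : {set 'I_n} :=
  [set i : 'I_n | descent s i].

Lemma des_half n (s : 'S_(2 * n.+1)) : s \in C132 (2 * n.+1) ->
  des s = (#|half_descents s|).*2 + descent s n.
Proof.
move=> sC; rewrite des_sum.
(* The last position 2n + 1 has no successor, so it contributes 0. *)
have -> : \sum_(i < 2 * n.+1) descent s i = \sum_(i < n.*2.+1) descent s i.
  rewrite -!(big_mkord predT (fun i => nat_of_bool (descent s i))).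
  rewrite (@big_cat_nat _ _ _ n.*2.+1) //=; last by lia.
  rewrite [X in _ + X]big_nat_cond [X in _ + X]big1 ?addn0 //.
  move=> i; rewrite andbT => im.
  by rewrite descent_out //; lia.
rewrite (@sum_palindrome n (fun i => nat_of_bool (descent s i))).
  rewrite /half_descents -sum1dep_card [in RHS]big_mkcond.
  by congr (_.*2 + _); apply: eq_bigr => i _; case: (descent s i).
move=> i i_n; rewrite -(C132_descent_mirror sC); last by lia.
by congr (nat_of_bool (descent s _)); lia.
Qed.

Lemma half_descents_inj n k :
  {in [set s in C132 (2 * n.+1) | des s == k] &, injective (@half_descents n)}.
Proof.
move=> s t /setIdP[sC /eqP sk] /setIdP[tC /eqP tk] st.
have low i : i < n -> descent s i = descent t i.
  by move=> i_n; have /setP/(_ (Ordinal i_n)) := st; rewrite !inE.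
(* The parity of k decides whether the middle position is a descent. *)
have mid : descent s n = descent t n.
  have := des_half sC; have := des_half tC; rewrite sk tk st => ->.
  by case: (descent s n); case: (descent t n) => //; lia.
apply: C132_descent_inj => // i im.
case: (ltngtP i n) => [/low //|ni|-> //].
rewrite -(C132_descent_mirror sC) // -(C132_descent_mirror tC) //.
by apply: low; lia.
Qed.

Lemma half_descents_exists n k (p : {set 'I_n}) : #|p| = k./2 ->
  exists2 s, s \in [set s in C132 (2 * n.+1) | des s == k] & half_descents s = p.
Proof.
move=> pk; pose mem_p i := oapp (fun j : 'I_n => j \in p) false (insub i).
have mem_p_out i : n <= i -> mem_p i = false.
  by move=> ni; rewrite /mem_p insubF // ltnNge ni.
(* The set [p], its mirror image, and the middle when k is odd. Only i <= 2n matters, where the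
   subtraction is exact. *)
pose d i := [|| mem_p i, mem_p (n.*2 - i) | (i == n) && odd k].
have dsym i : i.+1 < 2 * n.+1 -> d (2 * n.+1 - i.+2) = d i.
  move=> im; rewrite /d.
  have -> : 2 * n.+1 - i.+2 = n.*2 - i by lia.
  have -> : n.*2 - (n.*2 - i) = i by lia.
  have -> : (n.*2 - i == n) = (i == n) by lia.
  by rewrite orbCA.
have [s sC sd] := C132_descent_exists dsym.
have sp : half_descents s = p.
  apply/setP => i; have i_n := ltn_ord i; rewrite inE sd; last by lia.
  rewrite /d (mem_p_out (_ - _)); last by lia.
  by rewrite (ltn_eqF i_n) orbF /mem_p valK.
exists s => //; apply/setIdP; split=> //; apply/eqP.
rewrite (des_half sC) sp pk sd; last by lia.
rewrite /d !mem_p_out ?eqxx //=; last by lia.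
by rewrite addnC odd_double_half.
Qed.

(** For fixed k, [half_descents] is a bijection onto the subsets of ['I_n] of size [k./2]. *)
Lemma q_binomial n k : q n.+1 k = 'C(n, k./2).
Proof.
rewrite /q -(card_in_imset (@half_descents_inj n k)) -[n in 'C(n, _)]card_ord.
rewrite -card_draws; apply: eq_card => p; rewrite [RHS]inE.
apply/imsetP/eqP => [[s /setIdP[sC /eqP <-] ->]|/half_descents_exists[s sk <-]].
  by rewrite des_half // addnC half_bit_double.
by exists s.
Qed.

Lemma q0 k : q 0 k = (k == 0).
Proof.
have des0 (s : 'S_(2 * 0)) : des s = 0 by rewrite des_sum big_ord0.
have C0 (s : 'S_(2 * 0)) : s \in C132 (2 * 0).
  by rewrite inE; apply/andP; split; apply/forallP => -[].
rewrite /q; have -> : [set s in C132 (2 * 0) | des s == k] =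
    if k == 0 then [set 1%g] else set0.
  apply/setP => s; apply/setIdP/idP => [[_]|].
    rewrite des0 eq_sym => ->; rewrite inE; apply/eqP/permP => -[i i0].
    by exfalso; rewrite muln0 in i0.
  by case: eqP => [->|_]; rewrite inE // des0.
by case: eqP; rewrite ?cards1 ?cards0.
Qed.

End Counting.

(** * Coefficients and the generating function *)

Section Series.
Variable R : comNzRingType.

Lemma fpscoef_sum (I : Type) (r : seq I) (P : pred I) (F : I -> fps R) k :
  fpscoef (\sum_(i <- r | P i) F i) k = \sum_(i <- r | P i) fpscoef (F i) k.
Proof.
by elim/big_rec2: _ => [|i u v _ <-]; rewrite ?coef_fps0 ?coef_fpsD.
Qed.

Lemma coef_fpsCM (c : R) (f : fps R) n : fpscoef (fpsC c * f) n = c * fpscoef f n.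
Proof.
rewrite coef_fpsM big_ord_recl /= subn0 big1 ?addr0 // => i _.
by rewrite mul0r.
Qed.

(** Used with c = y: multiplication by 1 + y^2 then acts on each coefficient in x separately. *)
Lemma fpsC1D_sqr (c : R) : 1 + fpsC c ^+ 2 = fpsC (1 + c ^+ 2).
Proof.
apply/fpsP => n; rewrite coef_fpsD coef_fps1 expr2 coef_fpsCM /= expr2.
by case: eqP => _; rewrite ?mulr0 ?addr0.
Qed.

End Series.

Lemma Q_coef n k : fpscoef (fpscoef Q n) k = (q n k)%:Z.
Proof.
rewrite /= fpscoef_sum /q -sum1_card -natz natr_sum.
rewrite big_mkcond [RHS]big_mkcond; apply: eq_bigr => s _.
rewrite coef_fpsXn eq_sym [s \in [set _ in _ | _]]inE.
by case: (s \in C132 _) => //=; case: eqP.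
Qed.

Theorem theorem1 :
  [/\ Q = Fps (fun n => Fps (fun k => (q n k)%:Z)),
      Q = 1 + x * (1 + y) / (1 - x * (1 + y ^+ 2))
    & forall n k : nat, (1 <= n)%N -> q n k = 'C(n.-1, k./2)].
Proof.
split; [|apply/eqP|by case=> // n k _; exact: q_binomial].
  by apply/fpsP => n; apply/fpsP => k; rewrite Q_coef.
rewrite addrC -subr_eq eq_sym; apply/eqP.
(* Clearing the denominator leaves x(1 + y) = (Q - 1) - x(1 + y^2)(Q - 1), to be compared
   coefficientwise. *)
apply: (mulIr denominator_unit); rewrite divrK ?denominator_unit //.
rewrite mulrBr mulr1 mulrCA [(Q - 1) * _]mulrC fpsC1D_sqr.
have Q1 n k : fpscoef (fpscoef (Q - 1) n) k =
    if n is n'.+1 then 'C(n', k./2)%:Z else 0.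
  rewrite !coef_fpsD !coef_fpsN coef_fps1 Q_coef.
  case: n => [|n]; last by rewrite q_binomial coef_fps0 subr0.
  by rewrite q0 coef_fps1 natz subrr.
apply/fpsP => n; rewrite coef_fpsD coef_fpsN !coef_fpsXM.
case: n => [|n].
  by apply/fpsP => k; rewrite coef_fpsD coef_fpsN Q1 coef_fps0 subr0.
rewrite coef_fpsCM coef_fpsD coef_fps1.
case: n => [|n].
  (* At x^1, the binomial ['C(0, k./2)] is 1 exactly for k = 0 and k = 1, giving 1 + y. *)
  rewrite [fpscoef (Q - 1) 0](_ : _ = 0); last by apply/fpsP => k; rewrite Q1.
  apply/fpsP => k; rewrite mulr0 subr0 Q1 coef_fpsD coef_fps1 /=.
  by case: k => [|[|k]]; rewrite ?bin0 ?bin0n.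
have := Q1 n.+1; have := Q1 n.+2; rewrite [LHS]addr0.
move: (fpscoef (Q - 1) n.+2) (fpscoef (Q - 1) n.+1) => f g fE gE.
apply/fpsP => k; rewrite coef_fpsD coef_fpsN mulrDl mul1r expr2 -mulrA.
rewrite coef_fpsD fE gE coef_fps0.
(* What remains is f = (1 + y^2) g: for k < 2 both sides are 1, and from k = 2 on it is Pascal's
   rule, as adding 2 to k adds 1 to its half. *)
case: k => [|[|k]]; rewrite !coef_fpsXM ?gE -?[_.+2./2]/(_./2.+1).
- by rewrite !bin0 addr0 subrr.
- by rewrite !bin0 addr0 subrr.
- by rewrite binS PoszD subrr.
Qed.
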